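(* Let $F$ be a field, and let $(p_n)_{n \in \mathbb{N}}$ and $(q_n)_{n \in \mathbb{N}}$ be two strictly increasing sequences of odd primes such that $p_n < q_n < p_{n+1}$ for every $n \in \mathbb{N}$. Consider the additive submonoids of $\mathbb{Q}_{\ge 0}$ $$G_1 := \Big\langle \frac{1}{2^n p_n} \ \Big|\ n \in \mathbb{N} \Big\rangle \quad\text{and}\quad G_2 := \Big\langle \frac{1}{2^n q_n} \ \Big|\ n \in \mathbb{N} \Big\rangle,$$ and, for $i \in \{1,2\}$, let $L_i$ be the localization of the monoid algebra $F[G_i]$ at its multiplicative subset $\{f \in F[G_i] \mid f(0) \neq 0\}$ of polynomial expressions of order $0$. Regard $L_1$ and $L_2$ as subrings of the field of fractions of $F[\mathbb{Q}]$. Then the integral domain $L_1 \cap L_2$ is antimatter.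
   Context: $\mathbb{N}$ is the set of positive integers. For an additive submonoid $G$ of $\mathbb{Q}$, $F[G]$ is the monoid ring of polynomial expressions $\sum_i r_i X^{g_i}$ with coefficients $r_i\in F$ and exponents $g_i\in G$; it is a subring of the integral domain $F[\mathbb{Q}]$. The order of a nonzero $f\in F[G]$ is the smallest exponent appearing in $f$ with nonzero coefficient, and $f(0)$ is the coefficient of $X^0$ in $f$. An integral domain is antimatter if it contains no irreducible elements. *)

(* Defs.v *)
From HB Require Import structures.
From mathcomp Require Import all_boot all_order all_algebra.
From mathcomp Require Import finmap.
From mathcomp Require Import boolp classical_sets.
From mathcomp.multinomials Require Import monalg.

Set Implicit Arguments.
Unset Strict Implicit.
Unset Printing Implicit Defensive.

Import Order.TTheory GRing.Theory Num.Theory.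
Local Open Scope ring_scope.

Section ClassicalUnits.
Variable R : comNzRingType.

Definition cunit : {pred R} := fun x => `[< exists y : R, y * x = 1 >].

Definition cinv (x : R) : R :=
  if pselect (exists y : R, y * x = 1) is left h then projT1 (cid h) else x.

Lemma cmulVx : {in cunit, left_inverse 1 cinv *%R}.
Proof.
move=> x /asboolP ux; rewrite /cinv; case: pselect => // h.
by case: (cid h).
Qed.

Lemma cunitPl (x y : R) : y * x = 1 -> cunit x.
Proof. by move=> yx; apply/asboolP; exists y. Qed.

Lemma cinv_out : {in [predC cunit], cinv =1 id}.
Proof.
move=> x; rewrite inE => /negP nux; rewrite /cinv; case: pselect => // h.
by case: nux; apply/asboolP.
Qed.

End ClassicalUnits.

Definition irreducible_elt (R : idomainType) (a : R) : Prop :=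
  [/\ a != 0, a \isn't a GRing.unit &
      forall b c : R, a = b * c ->
        b \is a GRing.unit \/ c \is a GRing.unit].

Definition antimatter (R : idomainType) : Prop :=
  ~ exists a : R, irreducible_elt a.

(* The monoid algebra F[Q].  [malg] carries a ring structure only for
   exponent monoids in which 0 is the only invertible element, which
   excludes (Q, +); only its additive structure is reused here.
   [f@_k] is the coefficient of X^k in f. *)
Definition qalg (F : fieldType) : Type := {malg F[rat]}.

Section QAlgebra.
Variable F : fieldType.

HB.instance Definition _ := Choice.copy (qalg F) {malg F[rat]}.
HB.instance Definition _ := GRing.Zmodule.copy (qalg F) {malg F[rat]}.

Implicit Types (f g h : qalg F) (k l : rat).

Definition qone : qalg F := << 1 *g 0%R >>.

Definition qmul f g : qalg F :=
  \sum_(k <- msupp f) \sum_(l <- msupp g) << f@_k * g@_l *g (k + l)%R >>.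

Lemma qmulw (d1 d2 : {fset rat}) f g :
  (msupp f `<=` d1)%fset -> (msupp g `<=` d2)%fset ->
  qmul f g = \sum_(k <- d1) \sum_(l <- d2) << f@_k * g@_l *g (k + l)%R >>.
Proof.
move=> le1 le2; rewrite /qmul (big_fset_incl _ le1) /=.
  apply/eq_bigr=> k _; apply/big_fset_incl => // l _ /mcoeff_outdom ->.
  by rewrite mulr0 monalgU0.
move=> k _ /mcoeff_outdom fk.
by rewrite big1 // => l _; rewrite fk mul0r monalgU0.
Qed.

Lemma mcoeff_qmul f g k :
  (qmul f g)@_k = \sum_(a <- msupp f) f@_a * g@_(k - a)%R.
Proof.
rewrite /qmul raddf_sum; apply: eq_bigr => a _ /=; rewrite raddf_sum /=.
have E b : << f@_a * g@_b *g (a + b)%R >>@_k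
    = (f@_a * g@_b) *+ (b == k - a).
  by rewrite mcoeffU [a + b]addrC -subr_eq0 -[b == _]subr_eq0 opprB addrA.
rewrite (eq_bigr _ (fun b _ => E b)) => {E}.
case: (boolP (k - a \in msupp g)) => kg.
  rewrite (big_fsetD1 (k - a)) //= eqxx mulr1n big1_fset ?addr0 // => b.
  by rewrite in_fsetD1 => /andP[/negPf-> _] _; rewrite mulr0n.
rewrite (mcoeff_outdom kg) mulr0 big1_fset // => b bg _.
by case: eqP => [e|_]; [rewrite -e bg in kg|rewrite mulr0n].
Qed.

Lemma qmulC : commutative qmul.
Proof.
move=> f g; rewrite /qmul exchange_big /=; apply: eq_bigr => l _.
by apply: eq_bigr => k _; rewrite mulrC addrC.
Qed.

Lemma qmul1 : left_id qone qmul.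
Proof.
move=> g; apply/malgP => k; rewrite mcoeff_qmul /qone msuppU oner_eq0.
by rewrite big_seq_fset1 mcoeffUU mul1r subr0.
Qed.

Lemma qmulDl : left_distributive qmul +%R.
Proof.
move=> f g h.
rewrite (qmulw (fsubsetUl (msupp f) (msupp g)) (fsubset_refl (msupp h))).
rewrite (qmulw (fsubsetUr (msupp f) (msupp g)) (fsubset_refl (msupp h))).
rewrite (qmulw (msuppD_le _ _) (fsubset_refl (msupp h))).
rewrite -big_split /=; apply/eq_bigr=> k _.
rewrite -big_split /=; apply/eq_bigr=> l _.
by rewrite mcoeffD mulrDl monalgUD.
Qed.

Lemma qmul0 : left_zero 0 qmul.
Proof. by move=> g; rewrite /qmul msupp0 big_seq_fset0. Qed.

Lemma qmulDr : right_distributive qmul +%R.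
Proof. by move=> f g h; rewrite !(qmulC f) qmulDl. Qed.

Lemma qmulr0 : right_zero 0 qmul.
Proof. by move=> f; rewrite qmulC qmul0. Qed.

Lemma qmulUU (c d : F) k l :
  qmul << c *g k >> << d *g l >> = << c * d *g (k + l)%R >>.
Proof. by rewrite (qmulw msuppU_le msuppU_le) !big_seq_fset1 !mcoeffUU. Qed.

Lemma qmulA : associative qmul.
Proof.
move=> f g h; rewrite [f]monalgE [g]monalgE [h]monalgE.
have sl I (r : seq I) (E : I -> qalg F) x :
    qmul (\sum_(i <- r) E i) x = \sum_(i <- r) qmul (E i) x.
  exact: (big_morph (qmul^~ x) (fun _ _ => qmulDl _ _ _) (qmul0 _)).
have sr I (r : seq I) (E : I -> qalg F) x :
    qmul x (\sum_(i <- r) E i) = \sum_(i <- r) qmul x (E i).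
  exact: (big_morph (qmul x) (fun _ _ => qmulDr _ _ _) (qmulr0 _)).
rewrite !(sl _ (msupp f)); apply: eq_bigr => i _.
rewrite [X in _ = qmul X _](sr _ (msupp g)) !(sl _ (msupp g)) (sr _ (msupp g)); apply: eq_bigr => j _.
by rewrite !(sr _ (msupp h)); apply: eq_bigr => k _; rewrite !qmulUU mulrA addrA.
Qed.

Lemma qone_neq0 : qone != 0.
Proof. by rewrite monalgU_eq0 oner_eq0. Qed.

HB.instance Definition _ := GRing.Zmodule_isComNzRing.Build (qalg F)
  qmulA qmulC qmul1 qmulDl qone_neq0.

Lemma mcoeff_qalgM f g k :
  (f * g)@_k = \sum_(a <- msupp f) f@_a * g@_(k - a)%R.
Proof. exact: mcoeff_qmul. Qed.

Lemma mcoeff_qalg1 k : (1 : qalg F)@_k = (k == 0)%:R.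
Proof. by rewrite [LHS]mcoeffU eq_sym. Qed.

Lemma qalg_order f : f != 0 ->
  exists2 a, f@_a != 0 & forall k, k < a -> f@_k = 0.
Proof.
move=> f0; have [a af] : exists a, a \in msupp f.
  apply/fset0Pn; apply: contra_neq f0 => s0.
  by rewrite [f]monalgE s0 big_seq_fset0.
have [m] := @Order.TotalTheory.arg_minP _ _ _ [` af]%fset predT val isT.
move=> _ mmin; exists (val m); first by rewrite mcoeff_neq0 (valP m).
move=> k km; apply: mcoeff_outdom; apply/negP => kf.
by have := mmin [` kf]%fset isT; rewrite /= leNgt km.
Qed.

Lemma qalg_integral : GRing.integral_domain_axiom (qalg F).
Proof.
move=> f g fg0; apply/norP => -[/qalg_order[a fa amin] /qalg_order[b gb bmin]].
have := congr1 (mcoeff (a + b)) fg0; rewrite mcoeff_qalgM mcoeff0.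
rewrite (big_fsetD1 a) /=; last by rewrite -mcoeff_neq0.
rewrite [a + b]addrC addrK big1_fset ?addr0.
  by move/eqP; rewrite mulf_eq0 (negPf fa) (negPf gb).
move=> k; rewrite in_fsetD1 => /andP[ka _] _.
case: (ltgtP k a) ka => // [lt _|lt _]; first by rewrite amin // mul0r.
by rewrite bmin ?mulr0 // -addrA gtrDl subr_lt0.
Qed.

HB.instance Definition _ := GRing.ComNzRing_hasMulInverse.Build (qalg F)
  (@cmulVx (qalg F)) (@cunitPl (qalg F)) (@cinv_out (qalg F)).
HB.instance Definition _ := GRing.ComUnitRing_isIntegral.Build (qalg F)
  qalg_integral.

(* F[G], as the set of elements of F[Q] with all exponents in G. *)
Definition monoid_alg (G : set rat) : {pred qalg F} :=
  fun f => all (fun k => k \in G) (msupp f).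

Lemma monoid_algP (G : set rat) f :
  reflect (forall k, f@_k != 0 -> G k) (f \in monoid_alg G).
Proof.
apply: (iffP allP) => [h k|h k kf].
  by rewrite mcoeff_neq0 => /h; rewrite inE.
by rewrite inE; apply: h; rewrite mcoeff_neq0.
Qed.

(* The localization of F[G] at {g in F[G] | g(0) != 0}, inside Frac(F[Q]). *)
Definition localized0 (G : set rat) : {pred {fraction qalg F}} :=
  fun x => `[< exists f g : qalg F,
    [/\ f \in monoid_alg G, g \in monoid_alg G, g@_0%R != 0 &
        x = tofrac f / tofrac g] >].

End QAlgebra.

Definition is_submonoid (M : set rat) : Prop :=
  M 0 /\ forall x y, M x -> M y -> M (x + y).

Definition submonoid_gen (A : set rat) : set rat := smallest is_submonoid A.

(* < 1 / (2^n r_n) | n positive >; sequences are indexed by the positive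
   integers, so the value of r at 0 is not used. *)
Definition dyadic_monoid (r : nat -> nat) : set rat :=
  submonoid_gen
    [set x | exists2 n : nat, (0 < n)%N & x = (2 ^+ n * (r n)%:R)^-1].

Lemma submonoid_genP (A : set rat) : is_submonoid (submonoid_gen A).
Proof.
split=> [M [[M0 _] _] //|x y hx hy M [[M0 MD] AM]].
by apply: (MD); [exact: (hx M)|exact: (hy M)].
Qed.

Lemma dyadic_monoid_ge0 (r : nat -> nat) x : dyadic_monoid r x -> 0 <= x.
Proof.
apply: (@smallest_sub _ _ _ [set y : rat | 0 <= y]).
  by split=> //= y z; apply: addr_ge0.
by move=> _ [n _ ->] /=; rewrite invr_ge0 mulr_ge0 ?exprn_ge0 ?ler0n.
Qed.

Section Closure.
Variable F : fieldType.

Lemma monoid_alg_closed (G : set rat) :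
  is_submonoid G -> subring_closed (@monoid_alg F G).
Proof.
move=> [G0 GD]; split=> [|f g /monoid_algP fG /monoid_algP gG|
    f g /monoid_algP fG /monoid_algP gG]; apply/monoid_algP => k.
- by rewrite mcoeff_qalg1; have [->|_] := eqVneq k 0; rewrite ?eqxx.
- rewrite mcoeffB; have [f0|f0 _] := eqVneq f@_k 0; last exact: fG.
  by rewrite f0 sub0r oppr_eq0; apply: gG.
- move=> fgk; apply: contrapT => nGk; case/eqP: fgk.
  rewrite mcoeff_qalgM big1_fset // => a _ _.
  apply/eqP; rewrite mulf_eq0 -implyNb; apply/implyP => fa.
  apply: contra_notT nGk => gka; rewrite -[k](subrK a) addrC.
  by apply: GD; [apply: fG|apply: gG].
Qed.

Lemma mcoeff0M (G : set rat) (f g : qalg F) :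
  (forall x, G x -> 0 <= x) -> f \in monoid_alg G -> g \in monoid_alg G ->
  (f * g)@_0%R = f@_0%R * g@_0%R.
Proof.
move=> Gge0 /monoid_algP fG /monoid_algP gG.
have fgk k : k != 0 -> f@_k * g@_(0 - k)%R = 0.
  move=> k0; apply/eqP; rewrite mulf_eq0 -implyNb; apply/implyP => /fG/Gge0 kge.
  apply/contraT => /gG/Gge0; rewrite sub0r oppr_ge0 => kle.
  by rewrite (le_anti (introT andP (conj kle kge))) eqxx in k0.
rewrite mcoeff_qalgM; case: (msuppP f 0) => f0.
  rewrite (big_fsetD1 0) //= subr0 big1_fset ?addr0 // => k.
  by rewrite in_fsetD1 => /andP[k0 _] _; apply: fgk.
rewrite mul0r big1_fset // => k kf _; apply: fgk.
by apply: contraNneq f0 => <-.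
Qed.

Lemma localized0_closed (G : set rat) :
  is_submonoid G -> (forall x, G x -> 0 <= x) ->
  subring_closed (@localized0 F G).
Proof.
move=> GM Gge0; have [R1 RB RM] := monoid_alg_closed GM.
have nz (g : qalg F) : g@_0%R != 0 -> tofrac g != 0.
  by rewrite tofrac_eq0; apply: contra_neq => ->; rewrite mcoeff0.
split=> [|_ _ /asboolP[f [g [fG gG g0 ->]]] /asboolP[f' [g' [f'G g'G g'0 ->]]]|
  _ _ /asboolP[f [g [fG gG g0 ->]]] /asboolP[f' [g' [f'G g'G g'0 ->]]]];
  apply/asboolP.
- exists 1, 1; split=> //; first by rewrite mcoeff_qalg1 eqxx oner_eq0.
  by rewrite tofrac1 divr1.
- exists (f * g' - g * f'), (g * g'); split; rewrite ?RB ?RM //.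
    by rewrite (mcoeff0M Gge0) // mulf_neq0.
  rewrite tofracB !tofracM -mulNr addf_div ?nz //; congr (_ / _).
  by rewrite mulNr [tofrac g * _]mulrC.
- exists (f * f'), (g * g'); split; rewrite ?RM //.
    by rewrite (mcoeff0M Gge0) // mulf_neq0.
  by rewrite !tofracM mulf_div.
Qed.

HB.instance Definition _ (r : nat -> nat) :=
  GRing.isSubringClosed.Build {fraction qalg F} (localized0 (dyadic_monoid r))
    (localized0_closed (submonoid_genP _) (@dyadic_monoid_ge0 r)).

End Closure.

Definition subring_inter (R : nzRingType) (S1 S2 : {pred R}) : {pred R} :=
  fun x => (x \in S1) && (x \in S2).

Lemma subring_inter_closed (R : nzRingType) (S1 S2 : subringClosed R) :
  subring_closed (subring_inter S1 S2).
Proof.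
split=> [|x y /andP[x1 x2] /andP[y1 y2]|x y /andP[x1 x2] /andP[y1 y2]].
- by apply/andP; rewrite !rpred1.
- by apply/andP; rewrite !rpredB.
- by apply/andP; rewrite !rpredM.
Qed.

HB.instance Definition _ (R : nzRingType) (S1 S2 : subringClosed R) :=
  GRing.isSubringClosed.Build R (subring_inter S1 S2)
    (subring_inter_closed S1 S2).

(* A subring S of a field K, as an integral domain in its own right: its
   units are the elements with an inverse in S, not merely in K. *)
Section SubDomain.
Variables (K : fieldType) (S : subringClosed K).

Record subdomain : predArgType :=
  SubDomain { subdomain_val : K; _ : subdomain_val \in S }.

HB.instance Definition _ := [isSub for subdomain_val].
HB.instance Definition _ := [Choice of subdomain by <:].
HB.instance Definition _ := [SubChoice_isSubComNzRing of subdomain by <:].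
HB.instance Definition _ := GRing.ComNzRing_hasMulInverse.Build subdomain
  (@cmulVx subdomain) (@cunitPl subdomain) (@cinv_out subdomain).

Lemma subdomain_integral : GRing.integral_domain_axiom subdomain.
Proof.
move=> x y xy0; have /eqP := congr1 val xy0.
by rewrite rmorphM rmorph0 /= mulf_eq0 -!(rmorph0 (val : subdomain -> K)) !val_eqE.
Qed.

HB.instance Definition _ := GRing.ComUnitRing_isIntegral.Build subdomain
  subdomain_integral.

End SubDomain.

(* Main.v *)
Require Import Defs.
From HB Require Import structures.
From mathcomp Require Import all_boot all_order all_algebra.
From mathcomp Require Import finmap boolp classical_sets.
From mathcomp.multinomials Require Import monalg.
Import Order.TTheory GRing.Theory Num.Theory.

(** Let [D] be the monoid of nonnegative dyadic rationals.  The point is that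
    [L_1 ∩ L_2] is nothing but the localization of [F[D]] at its elements of
    order [0]; in that ring [X^a] has the factor [X^(a/2)] for every [a > 0].

    The inclusion of the localization of [F[D]] is clear, as [D] is contained
    in both monoids ([dyadic_ge0_sub]).  Conversely, let [x = f / g = f' / g']
    with [f, g] in [F[G_1]] and [f', g'] in [F[G_2]], so that
    [g' f = f' g] in [F[Q]].  Let [H] be the group of the rationals whose
    denominators have all their prime factors in [{2, q_1, q_2, ...}]; it
    contains [G_2], so [F[Q]] is graded by [Q / H] as an [F[H]]-module, and
    taking the terms with exponent in [H] is [F[H]]-linear ([restrM]).
    Applied to [g' f = f' g] this yields [g' f_0 = f' g_0], where [f_0] and
    [g_0] only have exponents in [G_1 ∩ H]; moreover [g_0(0) = g(0)] is
    nonzero, whence [x = f_0 / g_0] ([localized0_inter]).  Elements of [G_1]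
    have denominators with prime factors in [{2, p_1, p_2, ...}], and the
    [p_i] are distinct from the [q_j], so [G_1 ∩ H] is contained in [D].

    Finally let [x = u / v] with [u, v] in [F[D]] and [v(0)] nonzero.  If [u]
    has order [0], then [x] is invertible.  Otherwise the order [a] of [u] is
    a positive dyadic number, and [x = X^(a/2) * (X^(-a/2) u / v)] is a
    product of two elements of positive order ([dyadic_split]), which are not
    invertible ([localized0_nonunit]). *)

Section RationalDenominators.
Local Open Scope ring_scope.

(** The localization of the integers at the numbers with prime factors in
    [pi], as a subgroup of the rationals. *)
Definition den_in (pi : nat_pred) : {pred rat} :=
  fun x => pi.-nat `|denq x|%N.

(** Any common denominator will do, reduced or not: this is what makes closure
    under sums a matter of multiplying denominators. *)
Lemma den_inP (pi : nat_pred) (x : rat) :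
  reflect (exists2 d : nat, pi.-nat d & exists m : int, x * d%:R = m%:~R)
          (x \in den_in pi).
Proof.
apply: (iffP idP) => [xpi|[d pid [m xd]]].
  exists `|denq x|%N => //; exists (numq x).
  by rewrite pmulrn absz_denq numqE.
have E : numq x * d%:Z = m * denq x.
  apply/eqP; rewrite -(eqr_int rat) !rmorphM /= numqE -pmulrn mulrAC xd.
  by rewrite eqxx.
apply: pnat_dvd pid; rewrite -(@Gauss_dvdr _ `|numq x|).
  (* Passing to absolute values turns E into a divisibility of naturals. *)
  by rewrite -[d]/(`|d%:Z|%N) -abszM E abszM dvdn_mull.
by rewrite coprime_sym coprime_num_den.
Qed.

Lemma den_in_zmod_closed (pi : nat_pred) : zmod_closed (den_in pi).
Proof.
split=> [|x y /den_inP[d pid [m xd]] /den_inP[e pie [n ye]]].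
  by apply/den_inP; exists 1%N => //; exists 0; rewrite mul0r.
apply/den_inP; exists (d * e)%N; first by rewrite pnatM pid.
exists (m * e%:Z - n * d%:Z).
rewrite rmorphB !rmorphM /= -xd -ye -!pmulrn mulrBl.
by rewrite mulrA [y * _]mulrCA [d%:R * _]mulrC.
Qed.

HB.instance Definition _ (pi : nat_pred) :=
  GRing.isZmodClosed.Build rat (den_in pi) (den_in_zmod_closed pi).

Lemma den_in_sub (pi1 pi2 rho : nat_pred) :
  (forall l, l \in pi1 -> l \in pi2 -> l \in rho) ->
  forall x, x \in den_in pi1 -> x \in den_in pi2 -> x \in den_in rho.
Proof.
move=> sub x x1 x2.
have: [predI pi1 & pi2].-nat `|denq x|%N by rewrite pnatI; apply/andP.
by apply: sub_in_pnat => l _ /andP[]; apply: sub.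
Qed.

Definition den_primes (r : nat -> nat) : nat_pred :=
  [pred l | (l == 2%N) || `[< exists2 n : nat, (0 < n)%N & l = r n >]].

Definition dyadic_ge0 : set rat := [set x | 0 <= x /\ x \in den_in 2%N].

Lemma dyadic_monoid_den (r : nat -> nat) :
  (forall n, (0 < n)%N -> prime (r n)) ->
  forall x, dyadic_monoid r x -> x \in den_in (den_primes r).
Proof.
move=> rP x; apply: (@smallest_sub _ _ _ [set y | y \in den_in (den_primes r)]).
  by split=> /= [|y z]; [apply: rpred0|apply: rpredD].
move=> _ [n n0 ->] /=; apply/den_inP; exists (2 ^ n * r n)%N.
  rewrite pnatM pnatX pnatE // inE eqxx /= pnatE ?rP // inE.
  by apply/orP; right; apply/asboolP; exists n.
exists 1; rewrite natrM natrX mulVf // mulf_neq0 ?expf_neq0 //.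
by rewrite pnatr_eq0 -lt0n prime_gt0 ?rP.
Qed.

Lemma dyadic_ge0_sub (r : nat -> nat) :
  (forall n, (0 < n)%N -> prime (r n)) ->
  forall x, dyadic_ge0 x -> dyadic_monoid r x.
Proof.
move=> rP x [x0 /den_inP[_ /p_natP[m ->] [[k|k] xk]]]; last first.
  have : 0 <= x * (2 ^ m)%:R by rewrite mulr_ge0 ?ler0n.
  by rewrite xk ler0z.
have [M0 MD] := submonoid_genP
  [set x | exists2 n : nat, (0 < n)%N & x = (2 ^+ n * (r n)%:R)^-1].
have rn0 : (r m.+1)%:R != 0 :> rat by rewrite pnatr_eq0 -lt0n prime_gt0 ?rP.
have n2 n : 2 ^+ n != 0 :> rat by rewrite expf_neq0.
have -> : x = (2 ^+ m.+1 * (r m.+1)%:R)^-1 *+ (2 * k * r m.+1).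
  (* The factor 2 * r m.+1 moves k / 2 ^ m to a generator of positive index,
     which m itself need not be. *)
  rewrite -[RHS]mulr_natl !natrM invfM mulrACA mulfV // mulr1 exprS invfM mulrACA.
  by rewrite divff // mul1r -[k%:R]/(k%:~R) -xk natrX mulfK.
elim: (2 * k * _)%N => [|j IH]; first by rewrite mulr0n; apply: M0.
by rewrite mulrS; apply: MD IH => M [_]; apply; exists m.+1.
Qed.

End RationalDenominators.

Section Restriction.
Variable F : fieldType.
Local Open Scope ring_scope.
Implicit Types (f g : qalg F) (G : set rat).

(** The projection of [F[Q]] onto [F[H]] that drops the exponents outside
    [H]. *)
Definition restr (H : {pred rat}) f : qalg F :=
  [malg k in msupp f => if k \in H then f@_k else 0].

Lemma mcoeff_restr (H : {pred rat}) f k :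
  (restr H f)@_k = if k \in H then f@_k else 0.
Proof. by rewrite mcoeffE; case: msuppP => // _; case: ifP. Qed.

(** Multiplication by an element of [F[H]] preserves the cosets of [H] in
    which the exponents lie, so the projection onto one coset is linear. *)
Lemma restrM (H : zmodClosed rat) f g :
  g \in monoid_alg [set k | k \in H] -> restr H (g * f) = g * restr H f.
Proof.
move=> /monoid_algP gH; apply/malgP => k; rewrite mcoeff_restr !mcoeff_qalgM.
rewrite (_ : (if _ then _ else 0)
  = \sum_(a <- msupp g) if k \in H then g@_a * f@_(k - a) else 0); last first.
  by case: ifP => // _; rewrite big1_fset.
apply: eq_big_seq => a; rewrite -mcoeff_neq0 => /gH /= aH.
by rewrite mcoeff_restr rpredBr //; case: ifP => // _; rewrite mulr0.
Qed.

Lemma restr_monoid_alg (H : {pred rat}) G f :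
  f \in monoid_alg G -> restr H f \in monoid_alg [set k | G k /\ k \in H].
Proof.
move=> /monoid_algP fG; apply/monoid_algP => k; rewrite mcoeff_restr.
by case: ifP => [kH /fG|_ /eqP].
Qed.

Lemma monoid_algS G1 G2 f :
  (forall k, G1 k -> G2 k) -> f \in monoid_alg G1 -> f \in monoid_alg G2.
Proof.
by move=> s /monoid_algP f1; apply/monoid_algP => k /f1; apply: s.
Qed.

Lemma localized0S G1 G2 (x : {fraction qalg F}) :
  (forall k, G1 k -> G2 k) -> x \in localized0 G1 -> x \in localized0 G2.
Proof.
move=> s /asboolP[f [g [fG gG g0 ->]]]; apply/asboolP; exists f, g.
by split=> //; apply: monoid_algS s _.
Qed.

Lemma tofrac_neq0 g k : g@_k != 0 -> tofrac g != 0.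
Proof. by rewrite tofrac_eq0; apply: contra_neq => ->; rewrite mcoeff0. Qed.

(** Projecting the relation between two fractions that represent [x] replaces
    the numerator and the denominator of the first one by their parts in
    [F[H]]; the new denominator is nonzero because it keeps the coefficient
    of [X^0], whose exponent belongs to [H]. *)
Lemma localized0_inter (H : zmodClosed rat) G1 G2 (x : {fraction qalg F}) :
  (forall k, G2 k -> k \in H) ->
  x \in localized0 G1 -> x \in localized0 G2 ->
  x \in localized0 [set k | G1 k /\ k \in H].
Proof.
move=> G2H /asboolP[f [g [fG gG g0 xE]]] /asboolP[f' [g' [f'G g'G g'0 xE']]].
have rg0 : (restr H g)@_0 != 0 by rewrite mcoeff_restr rpred0.
apply/asboolP; exists (restr H f), (restr H g).
split=> //; try exact: restr_monoid_alg.
have /eqP : g' * f = f' * g.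
  apply/eqP; rewrite -tofrac_eq !tofracM mulrC -eqr_div ?(@tofrac_neq0 _ 0) //.
  by rewrite -xE -xE'.
move=> /eqP/(congr1 (restr H)); rewrite !restrM; try exact: monoid_algS G2H _.
move=> E; rewrite xE'; apply/eqP; rewrite eqr_div ?(@tofrac_neq0 _ 0) //.
by rewrite -!tofracM -E mulrC.
Qed.

(** On exponents that are all nonnegative, taking the coefficient of [X^0] is
    multiplicative, so an inverse of [u / v] would force [v(0)] to vanish. *)
Lemma localized0_nonunit G u v (y : {fraction qalg F}) :
  (forall k, G k -> 0 <= k) ->
  u \in monoid_alg G -> v \in monoid_alg G -> u@_0 = 0 -> v@_0 != 0 ->
  y \in localized0 G -> y * (tofrac u / tofrac v) != 1.
Proof.
move=> Gge0 uG vG u0 v0 /asboolP[f [g [fG gG g0 ->]]].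
have gv0 : (g * v)@_0 != 0 by rewrite (mcoeff0M Gge0) ?mulf_neq0.
rewrite mulf_div -!tofracM; apply/eqP => /divr1_eq/eqP.
rewrite tofrac_eq => /eqP/(congr1 (mcoeff 0)) E.
by move: gv0; rewrite -E (mcoeff0M Gge0) // u0 mulr0 eqxx.
Qed.

(** Halving the order [a] of [u] stays within the dyadic numbers, and every
    exponent of [u] is at least [a]: [u] is divisible by [X^(a/2)] in the
    monoid algebra, with a quotient of order [a/2]. *)
Lemma dyadic_split u :
  u != 0 -> u \in monoid_alg dyadic_ge0 -> u@_0 = 0 ->
  exists s t : qalg F,
    [/\ s \in monoid_alg dyadic_ge0, t \in monoid_alg dyadic_ge0,
        s@_0 = 0, t@_0 = 0 & u = s * t].
Proof.
move=> /qalg_order[a ua amin] uD u0; have /monoid_algP uDk := uD.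
have [a0 aH] := uDk _ ua.
have apos : 0 < a.
  by rewrite lt_neqAle a0 andbT eq_sym; apply: contra_neq ua => ->.
pose b := a / 2; have b0 : 0 < b by rewrite divr_gt0.
have ab : a = b + b by rewrite -mulr2n -mulr_natr mulfVK.
have bH : b \in den_in 2%N.
  have /den_inP[d pid [m am]] := aH.
  apply/den_inP; exists (d * 2)%N; first by rewrite pnatM pid.
  by exists m; rewrite natrM mulrA mulrAC mulfVK.
pose t : qalg F := (<< 1 *g - b >> : qalg F) * u.
have tE k : t@_k = u@_(b + k).
  rewrite mcoeff_qalgM msuppU oner_eq0 big_seq_fset1 mcoeffUU mul1r.
  by rewrite opprK addrC.
exists << 1 *g b >>, t; split.
- apply/monoid_algP => k; rewrite mcoeffU.
  by case: (b =P k) => [<- _|_ /eqP //]; split=> //; apply: ltW.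
- apply/monoid_algP => k; rewrite tE => uk; have [_ kH] := uDk _ uk.
  split; last by rewrite -(rpredDl k bH).
  have : ~~ (b + k < a) by apply: contraNN uk => /amin->.
  rewrite -leNgt ab lerD2l; apply: le_trans; exact: ltW.
- by rewrite mcoeffU gt_eqF.
- by rewrite tE addr0 amin // ab ltrDl.
have XbK : (<< 1 *g b >> : qalg F) * (<< 1 *g - b >> : qalg F) = 1.
  by rewrite [LHS]qmulUU mulr1 subrr.
by rewrite /t mulrA XbK mul1r.
Qed.

End Restriction.

Section Antimatter.
Variables (F : fieldType) (S : subringClosed {fraction qalg F}).
Local Open Scope ring_scope.

Lemma dyadic_fraction_unit (a : subdomain S) u v :
  (forall x, x \in S <-> x \in localized0 dyadic_ge0) ->
  u \in monoid_alg dyadic_ge0 -> v \in monoid_alg dyadic_ge0 ->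
  u@_0 != 0 -> v@_0 != 0 -> val a = tofrac u / tofrac v ->
  a \is a GRing.unit.
Proof.
move=> SE uD vD u0 v0 aE.
have iS : tofrac v / tofrac u \in S by apply/SE/asboolP; exists v, u.
have E : val a * (tofrac v / tofrac u) = 1.
  by rewrite aE mulf_div [X in _ / X]mulrC divff // mulf_neq0 ?(tofrac_neq0 _ _ 0).
by apply/unitrP; exists (SubDomain iS); split; apply: val_inj; rewrite // mulrC.
Qed.

Lemma dyadic_fraction_nonunit (a : subdomain S) u v :
  (forall x, x \in S <-> x \in localized0 dyadic_ge0) ->
  u \in monoid_alg dyadic_ge0 -> v \in monoid_alg dyadic_ge0 ->
  u@_0 = 0 -> v@_0 != 0 -> val a = tofrac u / tofrac v ->
  a \isn't a GRing.unit.
Proof.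
move=> SE uD vD u0 v0 aE; apply/negP => /unitrP[y [/(congr1 val)/eqP ya _]].
have /SE yD := valP y.
have ge0 k : dyadic_ge0 k -> 0 <= k by case.
by have /negP[] := localized0_nonunit _ _ _ _ _ ge0 uD vD u0 v0 yD; rewrite -aE.
Qed.

(** The domain is only assumed to have the same elements as the localization
    of [F[D]], so that this applies to an intersection of subrings. *)
Lemma antimatter_dyadic :
  (forall x, x \in S <-> x \in localized0 dyadic_ge0) ->
  antimatter (subdomain S).
Proof.
move=> SE [a [a0 aNu airr]].
have /SE/asboolP[u [v [uD vD v0 aE]]] := valP a.
have u0 : u@_0 = 0.
  by apply: contraNeq aNu => u0; apply: (dyadic_fraction_unit _ u v SE).
have un0 : u != 0.
  apply: contra_neq a0 => uE; apply: val_inj.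
  by rewrite aE uE tofrac0 mul0r.
have [s [t [sD tD s0 t0 uE]]] := dyadic_split _ _ un0 uD u0.
have oneD : (1 : qalg F) \in monoid_alg dyadic_ge0.
  apply/monoid_algP => k; rewrite mcoeff_qalg1.
  by case: (k =P 0) => [->|_ /eqP //]; split=> //; apply: rpred0.
have one0 : (1 : qalg F)@_0 != 0 by rewrite mcoeff_qalg1 oner_eq0.
have bS : tofrac s / tofrac 1 \in S by apply/SE/asboolP; exists s, 1.
have cS : tofrac t / tofrac v \in S by apply/SE/asboolP; exists t, v.
case: (airr (SubDomain bS) (SubDomain cS)).
- by apply: val_inj; rewrite /= aE uE tofracM tofrac1 divr1 mulrA.
- by apply/negP/(dyadic_fraction_nonunit _ s 1 SE).
- by apply/negP/(dyadic_fraction_nonunit _ t v SE).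
Qed.

End Antimatter.

Theorem proposition5p8 (F : fieldType) (p q : nat -> nat)
  (hp : forall n, 0 < n -> prime (p n) && odd (p n))
  (hq : forall n, 0 < n -> prime (q n) && odd (q n))
  (p_incr : forall m n, 0 < m -> m < n -> p m < p n)
  (q_incr : forall m n, 0 < m -> m < n -> q m < q n)
  (hpq : forall n, 0 < n -> p n < q n /\ q n < p n.+1) :
  antimatter
    (subdomain (subring_inter (@localized0 F (dyadic_monoid p))
                              (@localized0 F (dyadic_monoid q)))).
Proof.
have pP n : 0 < n -> prime (p n) by move/hp/andP=> [].
have qP n : 0 < n -> prime (q n) by move/hq/andP=> [].
have p_le m n : 0 < m -> m <= n -> p m <= p n.
  move=> m0; rewrite leq_eqVlt => /orP[/eqP->//|mn]; exact/ltnW/p_incr.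
have pq_neq m n : 0 < m -> 0 < n -> p m != q n.
  move=> m0 n0; have [pq qp] := hpq _ n0; rewrite neq_ltn.
  case: (leqP m n) => mn; first by rewrite (leq_ltn_trans (p_le _ _ m0 mn) pq).
  by rewrite (leq_trans qp (p_le _ _ (ltn0Sn n) mn)) orbT.
apply: antimatter_dyadic => x.
split=> [/andP[xp xq]|xD]; last first.
  by apply/andP; split; apply: localized0S xD; apply: dyadic_ge0_sub.
(* Here H is the group of the rationals with denominators built from q. *)
have := localized0_inter _ _ _ _ _ (dyadic_monoid_den q qP) xp xq.
apply: localized0S => k [kp kq]; split; first exact: dyadic_monoid_ge0 kp.
have kp' := dyadic_monoid_den p pP k kp.
apply: den_in_sub kp' kq => l /orP[/eqP-> //|/asboolP[m m0 ->]].
move=> /orP[/eqP-> //|/asboolP[n n0 e]].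
by have := pq_neq m n m0 n0; rewrite e eqxx.
Qed.
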